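(* Let $\mathbb{F}_q$ be a finite field, let $n\ge 1$, and let $r_1,\dots,r_n,i_1,\dots,i_n$ be positive integers. Let $$\mathcal{R}'=\frac{\mathbb{F}_q[x_1,\dots,x_n]}{\langle x_1^{r_1}-1,\dots,x_n^{r_n}-1\rangle},\qquad \mathcal{R}_{x_j}=\frac{\mathbb{F}_q[x_j]}{\langle x_j^{r_j}-1\rangle}\quad(1\le j\le n).$$ Suppose that $(x_j-1)^{i_j}$ divides $x_j^{r_j}-1$ in $\mathbb{F}_q[x_j]$ for all $1\le j\le n$. Let $C=\langle (x_1-1)^{i_1}\cdots(x_n-1)^{i_n}\rangle\subset\mathcal{R}'$ and $C_{x_j}=\langle (x_j-1)^{i_j}\rangle\subset\mathcal{R}_{x_j}$ be the indicated ideals. Then $C$ is the product of the codes $C_{x_j}$, i.e. $$C=(\cdots((C_{x_1}\otimes C_{x_2})\otimes C_{x_3})\otimes\cdots)\otimes C_{x_n}.$$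
   Context: An ideal of $\mathcal{R}'$ is regarded as a linear code: each element of $\mathcal{R}'$ has a unique representative $f=\sum f_{(a_1,\dots,a_n)}x_1^{a_1}\cdots x_n^{a_n}$ with $0\le a_j<r_j$, and it is identified with the array $(f_{(a_1,\dots,a_n)})$ of its coefficients, indexed by $\prod_{j}\{0,\dots,r_j-1\}$. Likewise, elements of $\mathcal{R}_{x_j}$ are identified with coefficient vectors indexed by $\{0,\dots,r_j-1\}$. Product of codes: for linear codes $C\subset\mathbb{F}_q^{I}$ and $C'\subset\mathbb{F}_q^{J}$ ($I,J$ finite index sets), $C\otimes C'\subset\mathbb{F}_q^{I\times J}$ is the linear code of all two-dimensional arrays $(c_{ij})_{i\in I,j\in J}$ such that $(c_{ij})_{i\in I}\in C$ for every fixed $j\in J$ and $(c_{ij})_{j\in J}\in C'$ for every fixed $i\in I$. In the iterated product, the index set $(I_1\times I_2)\times I_3$ etc. is identified with $I_1\times I_2\times I_3$ in the obvious way. *)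

(* Defs.v *)
From HB Require Import structures.
From mathcomp Require Import all_boot all_order all_algebra.
From mathcomp Require Import boolp classical_sets.
From mathcomp Require Import mpoly.

Set Implicit Arguments.
Unset Strict Implicit.
Unset Printing Implicit Defensive.

Import GRing.Theory.

Local Open Scope ring_scope.
Local Open Scope quotient_scope.
Local Open Scope classical_set_scope.

Definition principal_ideal (R : comNzRingType) (g : R) : set R :=
  [set f | exists h : R, f = h * g].

Definition product_code (F : finFieldType) (I J : finType)
    (C : set {ffun I -> F}) (D : set {ffun J -> F}) :
    set {ffun I * J -> F} :=
  [set c | (forall j : J, C [ffun i : I => c (i, j)]) /\
           (forall i : I, D [ffun j : J => c (i, j)])].

(* The index type (..(I_0 * I_1) * ..) * I_n and the code
   (..(D_0 (x) D_1) (x) ..) (x) D_n; the ordinal lift ord_max j has value j. *)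

Fixpoint iter_index (n : nat) : ('I_n.+1 -> finType) -> finType :=
  match n with
  | 0 => fun I => I ord0
  | m.+1 => fun I =>
      (iter_index (fun j : 'I_m.+1 => I (lift ord_max j))
         * I ord_max)%type
  end.

Fixpoint iter_product_code (F : finFieldType) (n : nat) :
    forall I : 'I_n.+1 -> finType,
    (forall j, set {ffun I j -> F}) -> set {ffun iter_index I -> F} :=
  match n with
  | 0 => fun I D => D ord0
  | m.+1 => fun I D =>
      product_code
        (iter_product_code
           (fun j : 'I_m.+1 => D (lift ord_max j)))
        (D ord_max)
  end.

(* The identification (a_0, .., a_n) |-> ((..(a_0, a_1), ..), a_n). *)

Fixpoint nest (n : nat) :
    forall I : 'I_n.+1 -> finType, (forall j, I j) -> iter_index I :=
  match n with
  | 0 => fun I a => a ord0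
  | m.+1 => fun I a =>
      (nest (fun j : 'I_m.+1 => a (lift ord_max j)), a ord_max)
  end.

Lemma nest_inj n (I : 'I_n.+1 -> finType) (a b : forall j, I j) :
  nest a = nest b -> forall j, a j = b j.
Proof.
elim: n I a b => [|n IH] I a b /= => [eq_ab j|[eq_ab eq_max] j].
  by rewrite (ord1 j).
by case: (unliftP ord_max j) => [k ->|-> //]; apply: (IH _ _ _ eq_ab k).
Qed.

Lemma nest_surj n (I : 'I_n.+1 -> finType) (t : iter_index I) :
  exists a : forall j, I j, nest a = t.
Proof.
elim: n I t => [|n IH] I /= => [t|[t u]].
  by exists (fun j => ecast j (I j) (esym (ord1 j)) t); rewrite eq_axiomK.
have [a <-] := IH _ t.
pose b j : I j := match unliftP ord_max j with
  | UnliftSome k jk => ecast j (I j) (esym jk) (a k)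
  | UnliftNone jmax => ecast j (I j) (esym jmax) u
  end.
exists b; congr pair; last first.
  rewrite /b; case: (unliftP ord_max ord_max) => [k e|e].
    by case/eqP: (neq_lift ord_max k).
  by rewrite eq_axiomK.
congr nest; apply: functional_extensionality_dep => k; rewrite /b.
case: (unliftP ord_max (lift ord_max k)) => [k' e|e].
  by have kk' := lift_inj e; subst k'; rewrite eq_axiomK.
by case/eqP: (neq_lift ord_max k).
Qed.

(* An array over the product index set, read off an array over nested
   pairs. *)
Definition unnest (F : finFieldType) (n : nat) (I : 'I_n.+1 -> finType)
    (c : {ffun iter_index I -> F}) : {ffun {dffun forall j, I j} -> F} :=
  [ffun a : {dffun forall j, I j} => c (nest a)].

Section UnivariateQuotient.
Variables (F : finFieldType) (r : nat).

(* For r > 0 the divisor is monic and nonconstant, so this is the actual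
   quotient by <'X^r - 1>. *)
Definition Runi := {poly %/ ('X^r - 1 : {poly F})}.

Definition uni_class (p : {poly F}) : Runi := in_qpoly ('X^r - 1) p.

(* An element of the quotient is identified with the coefficient array of its
   representative of degree < r. *)
Definition uni_code (S : set Runi) : set {ffun 'I_r -> F} :=
  [set c | S (uni_class (\sum_(i < r) c i *: 'X^i))].

End UnivariateQuotient.

Section MultivariateQuotient.
Variables (F : finFieldType) (n : nat) (r : 'I_n -> nat).

Definition rel_ideal : pred {mpoly F[n]} := fun p =>
  `[< exists h : 'I_n -> {mpoly F[n]},
        p = \sum_(j < n) h j * ('X_j ^+ r j - 1) >].

Fact rel_ideal_idealr : idealr_closed rel_ideal.
Proof.
split.
- by apply/asboolP; exists (fun=> 0); rewrite big1 // => j _; rewrite mul0r.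
- apply/negP => /asboolP [h /(congr1 (meval (fun=> 1)))].
  rewrite rmorph1 rmorph_sum big1 => [/eqP|j _]; first by rewrite oner_eq0.
  by rewrite rmorphM rmorphB rmorphXn /= mevalXU rmorph1 expr1n subrr mulr0.
move=> a _ _ /asboolP [h ->] /asboolP [k ->]; apply/asboolP.
exists (fun j => a * h j + k j).
rewrite mulr_sumr -big_split; apply: eq_bigr => j _ /=.
by rewrite mulrDl mulrA.
Qed.

HB.instance Definition _ :=
  isIdealr.Build {mpoly F[n]} rel_ideal rel_ideal_idealr.

Definition rel_idealr : idealr {mpoly F[n]} := rel_ideal.

Definition Rmulti : comNzRingType := {ideal_quot rel_idealr}.

Definition multi_class (p : {mpoly F[n]}) : Rmulti := \pi_Rmulti p.

(* Likewise, with the representative of degree < r j in 'X_j for all j. *)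
Definition multi_code (S : set Rmulti) :
    set {ffun {dffun forall j, 'I_(r j)} -> F} :=
  [set f | S (multi_class
     (\sum_(a : {dffun forall j, 'I_(r j)})
        f a *: \prod_(j < n) 'X_j ^+ a j))].

End MultivariateQuotient.

(* Main.v *)
(* Let g_j = (x_j - 1)^(i_j) and e_j(b) = (x_j^b div g_j) g_j. Since g_j divides
   x_j^(r_j) - 1, a codeword c of C_(x_j) is a polynomial divisible by g_j, so
   sum_b c_b x_j^b = sum_b c_b e_j(b). For an array in the product code this
   substitution can be made in one variable after the other, and the resulting
   polynomial is visibly a multiple of g_1 .. g_n.
   Conversely, reducing exponents modulo the r_j gives linear functionals on
   F[x_1, .., x_n] that vanish on the relations and read off coefficients, and
   they factor on products of univariate polynomials. So a multiple of
   g_1 .. g_n has as its array a linear combination of tensor products of the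
   codewords x_j^k g_j of C_(x_j). *)

From HB Require Import structures.
Require Import Defs.
From mathcomp Require Import all_boot all_order all_algebra.
From mathcomp Require Import boolp classical_sets.
From mathcomp Require Import ssrcomplements mpoly.

Set Implicit Arguments.
Unset Strict Implicit.
Unset Printing Implicit Defensive.

Import GRing.Theory.

Local Open Scope ring_scope.
Local Open Scope classical_set_scope.

(** The ring [A] is left general to serve both inclusions: over the field this is a pure tensor of
    codewords, over the polynomial ring it is the nested form of a product of univariate
    polynomials. *)
Fixpoint iter_tensor (A : comNzRingType) (n : nat) :
    forall I : 'I_n.+1 -> finType, (forall j, I j -> A) -> iter_index I -> A :=
  match n with
  | 0 => fun I u t => u ord0 t
  | m.+1 => fun I u t =>
      iter_tensor (fun j => u (lift ord_max j)) t.1 * u ord_max t.2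
  end.

Lemma iter_tensor_nest (A : comNzRingType) n (I : 'I_n.+1 -> finType)
    (u : forall j, I j -> A) (a : forall j, I j) :
  iter_tensor u (nest a) = \prod_j u j (a j).
Proof.
elim: n I u a => [|n IH] I u a /=; first by rewrite big_ord1.
by rewrite IH [RHS](bigD1_ord ord_max) //= mulrC.
Qed.

(** * Linear codes, their products and pure tensors *)

Section LinearCode.
Variable F : finFieldType.

Definition linear_code (I : finType) (C : set {ffun I -> F}) :=
  C 0 /\ forall (k : F) c d, C c -> C d -> C ([ffun x => k * c x] + d).

Lemma linear_code_sum (I : finType) (C : set {ffun I -> F}) (T : Type)
    (s : seq T) (k : T -> F) (c : T -> {ffun I -> F}) :
  linear_code C -> (forall x, C (c x)) ->
  C (\sum_(x <- s) [ffun i => k x * c x i]).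
Proof.
move=> [C0 CD] Cc; elim: s => [|x s IH]; first by rewrite big_nil.
by rewrite big_cons; apply: CD.
Qed.

Lemma product_code_linear (I J : finType) (C : set {ffun I -> F})
    (D : set {ffun J -> F}) :
  linear_code C -> linear_code D -> linear_code (product_code C D).
Proof.
move=> [C0 CD] [D0 DD]; split=> [|k c d [Cc Dc] [Cd Dd]]; split=> i.
- by rewrite (_ : finfun _ = 0) //; apply/ffunP => j; rewrite !ffunE.
- by rewrite (_ : finfun _ = 0) //; apply/ffunP => j; rewrite !ffunE.
- have := CD k _ _ (Cc i) (Cd i).
  by congr C; apply/ffunP => j; rewrite !ffunE.
- have := DD k _ _ (Dc i) (Dd i).
  by congr D; apply/ffunP => j; rewrite !ffunE.
Qed.

Lemma iter_product_code_linear n (I : 'I_n.+1 -> finType)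
    (D : forall j, set {ffun I j -> F}) :
  (forall j, linear_code (D j)) -> linear_code (iter_product_code D).
Proof.
elim: n I D => [|n IH] I D linD /=; first exact: linD.
by apply: product_code_linear; [apply: IH | apply: linD].
Qed.

Lemma linear_codeZ (I : finType) (C : set {ffun I -> F}) k c :
  linear_code C -> C c -> C [ffun x => k * c x].
Proof. by move=> [C0 CD] Cc; rewrite -[finfun _]addr0; apply: CD. Qed.

(** Fixing one coordinate of a pure tensor leaves a scalar multiple of the remaining factor, so
    linearity of the factors suffices. *)
Lemma iter_tensor_in_code n (I : 'I_n.+1 -> finType)
    (D : forall j, set {ffun I j -> F}) (w : forall j, I j -> F) :
  (forall j, linear_code (D j)) -> (forall j, D j (finfun (w j))) ->
  iter_product_code D (finfun (iter_tensor w)).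
Proof.
elim: n I D w => [|n IH] I D w linD Dw /=; first exact: Dw.
split=> [j|t].
  have C := iter_product_code_linear (fun j => linD (lift ord_max j)).
  have := linear_codeZ (w _ j) C (IH _ _ _ (fun j => linD _) (fun j => Dw _)).
  by congr iter_product_code; apply/ffunP => t; rewrite !ffunE mulrC.
have := linear_codeZ (iter_tensor (fun j => w (lift ord_max j)) t)
  (linD _) (Dw ord_max).
by congr (D _); apply/ffunP => j; rewrite !ffunE.
Qed.

(** Substitution in one variable after the other: first [u] becomes [v] in the last variable along
    each [c (t, _)], then the induction hypothesis treats each [c (_, b)]. *)
Lemma iter_product_code_subst (A : comAlgType F) n (I : 'I_n.+1 -> finType)
    (D : forall j, set {ffun I j -> F}) (u v : forall j, I j -> A)
    (c : {ffun iter_index I -> F}) :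
  (forall j d, D j d -> \sum_b d b *: u j b = \sum_b d b *: v j b) ->
  iter_product_code D c ->
  \sum_t c t *: iter_tensor u t = \sum_t c t *: iter_tensor v t.
Proof.
elim: n I D u v c => [|n IH] I D u v c uv /=; first exact: uv.
case=> Cc Dc.
have split_sum (f : _ -> A) (g : I ord_max -> A) :
    \sum_p c p *: (f p.1 * g p.2) = \sum_t \sum_b c (t, b) *: (f t * g b).
  by rewrite pair_bigA; apply: eq_bigr => -[].
rewrite !split_sum.
have uvD t : \sum_b c (t, b) *: u ord_max b = \sum_b c (t, b) *: v ord_max b.
  have := uv _ _ (Dc t).
  by congr (_ = _); apply: eq_bigr => b _; rewrite ffunE.
transitivity (\sum_t \sum_b c (t, b) *:
    (iter_tensor (fun j => u (lift ord_max j)) t * v ord_max b)).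
  apply: eq_bigr => t _; under eq_bigr do rewrite scalerAr.
  by rewrite -mulr_sumr uvD mulr_sumr; under eq_bigr do rewrite -scalerAr.
(* With the last index outermost, the inner sum runs over a word of the shorter product. *)
rewrite exchange_big [RHS]exchange_big; apply: eq_bigr => b _ /=.
under eq_bigr do rewrite scalerAl; under [RHS]eq_bigr do rewrite scalerAl.
rewrite -!mulr_suml; congr (_ * _).
have := IH _ _ _ (fun j => v (lift ord_max j)) _ (fun j d => uv _ d) (Cc b).
by congr (_ = _); apply: eq_bigr => t _; rewrite ffunE.
Qed.

End LinearCode.

(** * Codes in one variable and reduction modulo ['X^r - 1] *)

Section Univariate.
Variables (F : finFieldType) (r : nat).
Hypothesis r_gt0 : (0 < r)%N.

Lemma uni_class_eq (p q : {poly F}) :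
  uni_class r p = uni_class r q <-> ('X^r - 1) %| p - q.
Proof.
(* [mk_monic] replaces a constant or non-monic modulus by a default; [r_gt0] rules this out. *)
have mE : mk_monic ('X^r - 1 : {poly F}) = 'X^r - 1.
  by rewrite /mk_monic size_XnsubC // ltnS r_gt0 monicXnsubC.
have M : ('X^r - 1 : {poly F}) \is monic by rewrite monicXnsubC.
rewrite /uni_class /dvdp Pdiv.IdomainMonic.modpE //.
have rmodpB : Pdiv.Ring.rmodp (p - q) ('X^r - 1) =
    Pdiv.Ring.rmodp p ('X^r - 1) - Pdiv.Ring.rmodp q ('X^r - 1).
  by rewrite Pdiv.RingMonic.rmodpD // Pdiv.RingMonic.rmodpN.
rewrite rmodpB.
split=> [/(congr1 val)|].
  by rewrite /= mE => ->; rewrite subrr.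
by rewrite subr_eq0 => /eqP e; apply: val_inj; rewrite /= mE.
Qed.

Lemma uni_codeP (g : {poly F}) (c : {ffun 'I_r -> F}) :
  uni_code (principal_ideal (uni_class r g)) c <->
  exists q, ('X^r - 1) %| \sum_(b < r) c b *: 'X^b - q * g.
Proof.
split=> [[h e]|[q /uni_class_eq e]]; last first.
  by exists (uni_class r q); rewrite e /uni_class rmorphM.
exists (h : {poly F}); apply/uni_class_eq; rewrite e /uni_class rmorphM.
congr (_ * _); apply/esym/val_inj/in_qpoly_small.
exact: size_mk_monic.
Qed.

Lemma uni_code_linear (g : {poly F}) :
  linear_code (uni_code (principal_ideal (uni_class r g))).
Proof.
split=> [|k c d /uni_codeP[p cp] /uni_codeP[q dq]]; apply/uni_codeP.
  exists 0; rewrite mul0r subr0 big1 ?dvdp0 // => b _.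
  by rewrite ffunE scale0r.
exists (k *: p + q); under eq_bigr do rewrite !ffunE scalerDl -scalerA.
rewrite big_split -scaler_sumr mulrDl -scalerAl opprD addrACA -scalerBr.
by rewrite dvdp_add // -mul_polyC dvdp_mull.
Qed.

Lemma uni_code_dvd (g : {poly F}) (c : {ffun 'I_r -> F}) :
  g %| 'X^r - 1 -> uni_code (principal_ideal (uni_class r g)) c ->
  g %| \sum_(b < r) c b *: 'X^b.
Proof.
move=> g_dvd /uni_codeP[q /(dvdp_trans g_dvd)].
by rewrite dvdp_subl // dvdp_mull.
Qed.

(** For [size p <= N] this is the coefficient at [b] of [p] reduced modulo ['X^r - 1]. The bound [N]
    is a parameter so that several polynomials can share one summation range. *)
Definition fold_coef N (p : {poly F}) (b : 'I_r) : F :=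
  \sum_(k < N) p`_k * (k == b %[mod r])%:R.

Lemma poly_sum_widen N (p : {poly F}) : (size p <= N)%N ->
  p = \sum_(k < N) p`_k *: 'X^k.
Proof.
move=> pN; apply/polyP => k; rewrite -(poly_def N (nth 0 p)) coef_poly.
by case: ltnP => // Nk; rewrite nth_default // (leq_trans pN).
Qed.

Lemma fold_coef_dvd N (p : {poly F}) : (size p <= N)%N ->
  ('X^r - 1) %| \sum_(b < r) fold_coef N p b *: 'X^b - p.
Proof.
move=> pN; have -> : \sum_(b < r) fold_coef N p b *: 'X^b
    = \sum_(k < N) p`_k *: 'X^(k %% r).
  under eq_bigr do rewrite scaler_suml; rewrite exchange_big.
  apply: eq_bigr => k _ /=.
  rewrite (bigD1 (Ordinal (ltn_pmod k r_gt0))) //= modn_mod eqxx mulr1.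
  rewrite big1 ?addr0 // => b; rewrite -val_eqE /= eq_sym => /negPf kb.
  by rewrite [(b %% r)%N]modn_small // kb mulr0 scale0r.
rewrite {2}(poly_sum_widen pN) -sumrB; elim/big_ind: _ => [||k _].
- exact: dvdp0.
- exact: dvdp_add.
(* Writing k = q r + s with s < r, the difference x^s - x^k is -((x^r)^q - 1) x^s, a multiple of x^r
   - 1. *)
rewrite -scalerBr -mul_polyC dvdp_mull // {2}(divn_eq k r) exprD mulnC exprM.
rewrite -{1}['X^(k %% r)]mul1r -mulrBl dvdp_mulr // -dvdpNr opprB.
by rewrite [X in _ %| X]subrX1 dvdp_mulr.
Qed.

End Univariate.

(** * Linear functionals prescribed on monomials *)

Section MonomialFunctional.
Variables (F : finFieldType) (n : nat) (phi : 'X_{1..n} -> F).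

Definition mfun (p : {mpoly F[n]}) : F := \sum_(m <- msupp p) p@_m * phi m.

(** The support varies with the polynomial; a common index set of monomials of bounded degree makes
    linearity a termwise identity. *)
Lemma mfun_widen k p : (msize p <= k)%N ->
  mfun p = \sum_(m : 'X_{1..n < k}) p@_m * phi m.
Proof.
move=> pk; rewrite /mfun (big_mksub 'X_{1..n < k}) ?msupp_uniq //=; last first.
  by move=> m /msize_mdeg_lt /leq_trans; apply.
by rewrite big_rmcond //= => m /memN_msupp_eq0 ->; rewrite mul0r.
Qed.

Lemma mfun_is_linear : linear_for *%R mfun.
Proof.
move=> c p q; set k := maxn (msize (c *: p + q)) (maxn (msize p) (msize q)).
have [k1 k2 k3] : [/\ msize (c *: p + q) <= k, msize p <= k & msize q <= k]%N.
  by rewrite /k !leq_max !leqnn !orbT.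
rewrite !(@mfun_widen k) // mulr_sumr -big_split; apply: eq_bigr => m _ /=.
by rewrite mcoeffD mcoeffZ mulrDl mulrA.
Qed.

HB.instance Definition _ :=
  GRing.isLinear.Build F {mpoly F[n]} F *%R mfun mfun_is_linear.

Lemma mfunX m : mfun 'X_[m] = phi m.
Proof. by rewrite /mfun msuppX big_seq1 mcoeffX eqxx mul1r. Qed.

End MonomialFunctional.

(** * The multivariate quotient and its coefficient functionals *)

Section Multivariate.
Variables (F : finFieldType) (n : nat) (r : 'I_n -> nat).

Lemma multi_class_eq (p q : {mpoly F[n]}) :
  multi_class r p = multi_class r q <-> rel_ideal r (p - q).
Proof.
rewrite /multi_class.
have := Quotient.idealrBE (rel_idealr F r) p q.
rewrite /in_mem /= => ->; split=> [e|/eqP //]; exact/eqP.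
Qed.

Lemma multi_codeP (g : {mpoly F[n]})
    (f : {ffun {dffun forall j, 'I_(r j)} -> F}) :
  multi_code (principal_ideal (multi_class r g)) f <->
  exists q, rel_ideal r (\sum_(a : {dffun forall j, 'I_(r j)})
      f a *: \prod_(j < n) 'X_j ^+ a j - q * g).
Proof.
split=> [[h e]|[q /multi_class_eq e]]; last first.
  by exists (multi_class r q); rewrite e /multi_class rmorphM.
exists (repr h); apply/multi_class_eq; rewrite e.
transitivity (multi_class r (repr h) * multi_class r g).
  by congr (_ * _); rewrite /multi_class reprK.
by rewrite /multi_class rmorphM.
Qed.

(** Extended by [mfun], this reads off the coefficient of x^b after each exponent of x_j is reduced
    modulo r_j. *)
Definition residue_fun (b : forall j, 'I_(r j)) (m : 'X_{1..n}) : F :=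
  \prod_j (m j == b j %[mod r j])%:R.

(** Multiplying a monomial by x_j^(r_j) preserves all residues, so the two terms of x^m (x_j^(r_j) -
    1) cancel. *)
Lemma mfun_rel_ideal b p : rel_ideal r p -> mfun (residue_fun b) p = 0.
Proof.
move=> /asboolP[h ->]; rewrite linear_sum big1 // => j _ /=.
rewrite [h j]mpolyE mulr_suml linear_sum big1 // => m _ /=.
rewrite -scalerAl linearZ /= mulrBr mulr1 mpolyXn -mpolyXD linearB /= !mfunX.
rewrite (_ : residue_fun b _ = residue_fun b m) ?subrr ?mulr0 //.
apply: eq_bigr => k _; rewrite mnmDE mulmnE mnm1E.
by case: (eqVneq j k) => [->|_]; rewrite ?mul0n ?addn0 // mul1n modnDr.
Qed.

(** [residue_fun] is a product of conditions on single exponents, so the functional factors once the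
    product of sums is expanded. Here [horner_alg 'X_j] reads a univariate polynomial as one in
    x_j. *)
Lemma mfun_prod N (b : forall j, 'I_(r j)) (p : 'I_n -> {poly F}) :
  (forall j, (size (p j) <= N)%N) ->
  mfun (residue_fun b) (\prod_j horner_alg 'X_j (p j)) =
  \prod_j fold_coef N (p j) (b j).
Proof.
move=> pN.
have pE j : horner_alg ('X_j : {mpoly F[n]}) (p j)
    = \sum_(k < N) (p j)`_k *: 'X_j ^+ k.
  rewrite {1}(poly_sum_widen (pN j)) linear_sum.
  apply: eq_bigr => k _.
  by rewrite linearZ /= rmorphXn /= horner_algX mulr_algl.
under eq_bigr do rewrite pE.
rewrite !bigA_distr_bigA linear_sum; apply: eq_bigr => /= t _.
rewrite scaler_prod linearZ /= big_split /=; congr (_ * _).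
rewrite -(_ : 'X_[[multinom (t j : nat) | j < n]] = \prod_j 'X_j ^+ t j).
  by rewrite mfunX; apply: eq_bigr => j _; rewrite mnmE.
by rewrite mpolyXE_id; apply: eq_bigr => j _; rewrite mnmE.
Qed.

Lemma mfun_residue (f : {ffun {dffun forall j, 'I_(r j)} -> F})
    (b : {dffun forall j, 'I_(r j)}) :
  mfun (residue_fun b) (\sum_(a : {dffun forall j, 'I_(r j)})
      f a *: \prod_(j < n) 'X_j ^+ a j) = f b.
Proof.
rewrite linear_sum (bigD1 b) //= linearZ /=.
have X (a : {dffun forall j, 'I_(r j)}) :
    mfun (residue_fun b) (\prod_(j < n) 'X_j ^+ a j) = (a == b)%:R.
  rewrite -(_ : 'X_[[multinom (a j : nat) | j < n]] = \prod_j 'X_j ^+ a j).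
    rewrite mfunX /residue_fun; case: eqVneq => [->|].
      by rewrite big1 // => j _; rewrite mnmE eqxx.
    move=> /eqP ab; have [j jab] : exists j, a j != b j.
      apply/existsP; rewrite -negb_forall; apply/negP => /forallP ab'.
      by apply/ab/ffunP => j; apply/eqP.
    by rewrite (bigD1 j) //= mnmE !modn_small // val_eqE (negPf jab) mul0r.
  by rewrite mpolyXE_id; apply: eq_bigr => j _; rewrite mnmE.
rewrite X eqxx mulr1 big1 ?addr0 // => a /negPf ab.
by rewrite linearZ /= X ab mulr0.
Qed.

End Multivariate.

(** * The product decomposition for arbitrary divisors g_j *)

Lemma nest_bij n (I : 'I_n.+1 -> finType) :
  bijective (fun a : {dffun forall j, I j} => nest a).
Proof.
have surj (t : iter_index I) : exists a : {dffun forall j, I j}, nest a == t.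
  have [a <-] := nest_surj t; exists (finfun a); apply/eqP; congr nest.
  by apply: functional_extensionality_dep => j; rewrite ffunE.
exists (fun t => xchoose (surj t)) => [a|t]; last exact/eqP/(xchooseP (surj t)).
by apply/ffunP/nest_inj/eqP/(xchooseP (surj (nest a))).
Qed.

Theorem multi_code_principal (F : finFieldType) (n : nat) (r : 'I_n.+1 -> nat)
    (g : 'I_n.+1 -> {poly F}) :
  (forall j, (0 < r j)%N) -> (forall j, g j %| 'X^(r j) - 1) ->
  multi_code (principal_ideal
    (multi_class r (\prod_j horner_alg ('X_j : {mpoly F[n.+1]}) (g j))))
  = @unnest F n (fun j => 'I_(r j)) @`
      iter_product_code (fun j =>
        uni_code (principal_ideal (uni_class (r j) (g j)))).
Proof.
move=> r_gt0 g_dvd; apply/seteqP; split=> f.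
  move=> /multi_codeP[h hf].
  have [nestV nestK nestVK] := nest_bij (fun j => 'I_(r j)).
  exists [ffun t => f (nestV t)]; last first.
    by apply/ffunP => a; rewrite !ffunE nestK.
  (* [p m j] is the x_j-factor of x^m g_1 .. g_n, for each monomial x^m of the cofactor [h]. *)
  pose p (m : 'X_{1..n.+1}) j : {poly F} := 'X^(m j) * g j.
  pose N m := (\max_j size (p m j))%N.
  have -> : [ffun t => f (nestV t)] = \sum_(m <- msupp h) [ffun t => h@_m *
      finfun (iter_tensor (fun j => @fold_coef F (r j) (N m) (p m j))) t].
    apply/ffunP => t; rewrite -(nestVK t); move: (nestV t) => b.
    rewrite ffunE nestK sum_ffunE -(mfun_residue f b).
    (* The functional at [b] takes the same value on the polynomial of [f] and on [h] times the
       generator, and the latter splits over the monomials of [h]. *)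
    move: (mfun_rel_ideal b hf); rewrite linearB /= => /eqP.
    rewrite subr_eq0 => /eqP ->; rewrite [h in h * _]mpolyE mulr_suml.
    rewrite linear_sum; apply: eq_bigr => m _.
    rewrite !ffunE iter_tensor_nest -scalerAl linearZ /=.
    rewrite -mfun_prod => [|j]; last exact: (leq_bigmax_cond j).
    rewrite mpolyXE_id -big_split /=; congr (_ * mfun _ _).
    by apply: eq_bigr => j _; rewrite rmorphM [in RHS]rmorphXn /= horner_algX.
  have lin j := uni_code_linear (r_gt0 j) (g j).
  apply: linear_code_sum => [|m]; first exact: iter_product_code_linear.
  apply: iter_tensor_in_code => // j; apply/uni_codeP => //.
  exists 'X^(m j); under eq_bigr do rewrite ffunE.
  by apply: fold_coef_dvd => //; exact: (leq_bigmax_cond j).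
case=> c Cc <-; apply/multi_codeP.
pose u j (b : 'I_(r j)) : {mpoly F[n.+1]} := 'X_j ^+ b.
(* This is e_j(b), the monomial x_j^b without its remainder modulo g_j. *)
pose v j (b : 'I_(r j)) : {mpoly F[n.+1]} :=
  horner_alg 'X_j ('X^b %/ g j) * horner_alg 'X_j (g j).
have uv j d : uni_code (principal_ideal (uni_class (r j) (g j))) d ->
    \sum_b d b *: u j b = \sum_b d b *: v j b.
  move=> /(uni_code_dvd (r_gt0 j) (g_dvd j)) /divpK e.
  transitivity (horner_alg 'X_j (\sum_(b < r j) d b *: 'X^b) : {mpoly F[n.+1]}).
    rewrite linear_sum; apply: eq_bigr => b _.
    by rewrite linearZ /= rmorphXn /= horner_algX mulr_algl.
  rewrite -e rmorphM /=.
  (* Division by g_j is linear, so the quotient of the codeword is the combination of the quotients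
     of its monomials. *)
  rewrite (big_morph _ (fun x y => divpD (g j) x y) (div0p (g j))).
  rewrite linear_sum mulr_suml; apply: eq_bigr => b _.
  by rewrite divpZl linearZ /= mulr_algl scalerAl.
have := iter_product_code_subst uv Cc.
rewrite !(reindex _ (onW_bij _ (nest_bij _))) /= => e.
(* The cofactor left after extracting g_1 .. g_n from each product of the e_j; the difference is
   then zero already as a polynomial. *)
exists (\sum_(a : {dffun forall j, 'I_(r j)})
  c (nest a) *: \prod_j horner_alg 'X_j ('X^(a j) %/ g j)).
rewrite (_ : _ - _ = 0); first exact: rpred0.
under eq_bigr do rewrite ffunE; apply/eqP; rewrite subr_eq0; apply/eqP.
move: e; under eq_bigr do rewrite iter_tensor_nest; move=> ->.
rewrite mulr_suml; apply: eq_bigr => a _.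
by rewrite iter_tensor_nest -scalerAl big_split.
Qed.

Theorem theorem3p4 (F : finFieldType) (n : nat) (r i : 'I_n.+1 -> nat)
    (r_gt0 : forall j, (0 < r j)%N) (i_gt0 : forall j, (0 < i j)%N)
    (dvd_ri : forall j,
       (('X - 1) ^+ i j : {poly F}) %| ('X^(r j) - 1 : {poly F})) :
  multi_code (principal_ideal
    (multi_class r (\prod_(j < n.+1) ('X_j - 1) ^+ i j : {mpoly F[n.+1]})))
  = @unnest F n (fun j => 'I_(r j)) @`
      iter_product_code (fun j =>
        uni_code (principal_ideal
          (uni_class (r j) (('X - 1) ^+ i j : {poly F})))).
Proof.
have prodE : \prod_j ('X_j - 1 : {mpoly F[n.+1]}) ^+ i j =
    \prod_j horner_alg 'X_j (('X - 1) ^+ i j).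
  by apply: eq_bigr => j _; rewrite rmorphXn rmorphB /= horner_algX rmorph1.
by rewrite prodE multi_code_principal.
Qed.
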